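(* Let $\mathcal C$ be a graph class, and for each positive integer $s$ let $\alpha(s)=\max\{\rho_1(H): H\in\mathcal C,\ |V(H)|=s\}$. Assume that $\alpha(s)$ is strictly increasing in $s$. Let $G\in\mathcal C$ be of order $n\ge 2$. Then $$\rho_2(G)\le\alpha(\lfloor n/2\rfloor).$$ Equality holds if and only if one of the following alternatives holds. (1) If $n$ is even, then equality holds if and only if $G$ is of the form $G_1^*(n/2)\cup G_2^*(n/2)$, where $G_1^*(n/2),G_2^*(n/2)\in\mathcal C$ and $\rho_1(G_1^*(n/2))=\rho_1(G_2^*(n/2))=\alpha(n/2)$. (2) If $n$ is odd, then equality holds if and only if $G$ is of the form $G_1^*(\lfloor n/2\rfloor)\cup G_2(\lceil n/2\rceil)$ or $G_1^*(\lfloor n/2\rfloor)\bullet K_1\bullet G_2^*(\lfloor n/2\rfloor)$, where $G_1^*(\lfloor n/2\rfloor),G_2^*(\lfloor n/2\rfloor),G_2(\lceil n/2\rceil)\in\mathcal C$, $\rho_1(G_1^*(\lfloor n/2\rfloor))=\rho_1(G_2^*(\lfloor n/2\rfloor))=\alpha(\lfloor n/2\rfloor)$, and $\rho_1(G_2(\lceil n/2\rceil))\ge\rho_1(G_1^*(\lfloor n/2\rfloor))$. In particular, equality holds when $G$ is of the form $2G_1^*(\lfloor n/2\rfloor)\cup K_1$ or $G_1^*(\lfloor n/2\rfloor)\cup G_1^*(\lceil n/2\rceil)$. Moreover, if $G$ is connected, then equality holds if and only if $n$ is odd and $G$ is of the form $G_1^*(\lfloor n/2\rfloor)\bullet K_1\bullet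 G_2^*(\lfloor n/2\rfloor)$, where $G_1^*(\lfloor n/2\rfloor),G_2^*(\lfloor n/2\rfloor)\in\mathcal C$, $G_1^*(\lfloor n/2\rfloor)\bullet K_1\bullet G_2^*(\lfloor n/2\rfloor)\in\mathcal C$, and $\rho_1(G_1^*(\lfloor n/2\rfloor))=\rho_1(G_2^*(\lfloor n/2\rfloor))=\alpha(\lfloor n/2\rfloor)$.
   Context: All graphs are finite, simple and undirected. For a graph $G$ of order $n$ with adjacency matrix $A(G)$, $\rho_1(G)\ge\rho_2(G)\ge\cdots\ge\rho_n(G)$ are the eigenvalues of $A(G)$; $\rho_1$ is the adjacency spectral radius. Notation: $G(s)$ (with any subscript or star) denotes a graph of order $s$; a star, as in $G_i^*(s)$, indicates a graph in $\mathcal C$ of order $s$ with $\rho_1(G_i^*(s))=\alpha(s)$. $G\cup H$ is the disjoint union, and $2H$ is the disjoint union of two copies of $H$. $G_1\bullet K_1\bullet G_2$ is the set of connected graphs obtained from the disjoint union $G_1\cup G_2$ by adding one additional vertex (the $K_1$) and adding some edges from vertices of $G_1$ and $G_2$ to this additional vertex; ''$G$ is of the form $G_1\bullet K_1\bullet G_2$'' means that $G$ is a member of this set.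
   Formalization: ''Graph class'' is taken to mean closed under isomorphism and nonempty induced subgraphs; for arbitrary families the claim fails, e.g. P_s (s<10), 2K_5 (s=10), K_s (s>10), where ρ_2(2K_5)=4>α(5)=√3. *)

(* Defs.v *)
From HB Require Import structures.
From mathcomp Require Import all_boot all_order all_algebra.
From mathcomp Require Import polyrcf reals.

Set Implicit Arguments.
Unset Strict Implicit.
Unset Printing Implicit Defensive.

Import Order.TTheory GRing.Theory Num.Theory.
Local Open Scope ring_scope.

Record sgraph := SGraph {
  vert : finType;
  edge : rel vert;
  edge_sym : symmetric edge;
  edge_irrefl : irreflexive edge }.

Definition gorder (G : sgraph) : nat := #|vert G|.

Definition isog (G H : sgraph) : Prop :=
  exists2 f : vert G -> vert H,
    bijective f & forall x y, edge (f x) (f y) = edge x y.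

Definition connectedg (G : sgraph) : Prop :=
  (0 < gorder G)%N /\ forall x y : vert G, connect (@edge G) x y.

Section Induced.
Variables (G : sgraph) (S : {set vert G}).
Definition induced_edge : rel {x : vert G | x \in S} :=
  fun x y => edge (val x) (val y).
Lemma induced_sym : symmetric induced_edge.
Proof. by move=> x y; apply: edge_sym. Qed.
Lemma induced_irrefl : irreflexive induced_edge.
Proof. by move=> x; apply: edge_irrefl. Qed.
Definition induced : sgraph := SGraph induced_sym induced_irrefl.
End Induced.

Section DisjointUnion.
Variables G1 G2 : sgraph.
Definition gunion_edge : rel (vert G1 + vert G2)%type := fun x y =>
  match x, y with
  | inl a, inl b => edge a b
  | inr a, inr b => edge a b
  | _, _ => false
  end.
Lemma gunion_sym : symmetric gunion_edge.
Proof. by case=> a [] b //=; apply: edge_sym. Qed.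
Lemma gunion_irrefl : irreflexive gunion_edge.
Proof. by case=> a /=; apply: edge_irrefl. Qed.
Definition gunion : sgraph := SGraph gunion_sym gunion_irrefl.
End DisjointUnion.

(* [add_vertex N] is [G] with one new vertex, [None], whose neighbourhood is
   [N]. *)
Section AddVertex.
Variables (G : sgraph) (N : {set vert G}).
Definition add_vertex_edge : rel (option (vert G)) := fun x y =>
  match x, y with
  | Some a, Some b => edge a b
  | Some a, None | None, Some a => a \in N
  | None, None => false
  end.
Lemma add_vertex_sym : symmetric add_vertex_edge.
Proof. by case=> [a|] [b|] //=; apply: edge_sym. Qed.
Lemma add_vertex_irrefl : irreflexive add_vertex_edge.
Proof. by case=> [a|] //=; apply: edge_irrefl. Qed.
Definition add_vertex : sgraph := SGraph add_vertex_sym add_vertex_irrefl.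
End AddVertex.

Definition K1 : sgraph :=
  @SGraph unit (fun _ _ => false) (fun _ _ => erefl) (fun _ => erefl).

(* Membership, up to isomorphism, in the set G1 . K1 . G2. *)
Definition bullet (G1 G2 G : sgraph) : Prop :=
  exists N : {set vert (gunion G1 G2)},
    connectedg (add_vertex N) /\ isog G (add_vertex N).

Definition adjmx (R : realType) (G : sgraph) : 'M[R]_(gorder G) :=
  \matrix_(i, j) (edge (enum_val i) (enum_val j))%:R.

(* The real roots of the characteristic polynomial of A(G), in nonincreasing
   order, each repeated according to its multiplicity. Since A(G) is symmetric
   these are all its eigenvalues, and the list has length [gorder G]. *)
Definition spectrum (R : realType) (G : sgraph) : seq R :=
  let p := char_poly (adjmx R G) in
  flatten [seq nseq (mup x p) x | x <- rev (rootsR p)].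

(* The [i]-th largest eigenvalue, [i] counted from 1; junk value unless
   [1 <= i <= gorder G]. *)
Definition rho (R : realType) (i : nat) (G : sgraph) : R :=
  (spectrum R G)`_i.-1.

(* A graph class is isomorphism-closed and hereditary (closed under nonempty
   induced subgraphs). *)
Definition graph_class (C : sgraph -> Prop) : Prop :=
  (forall G H, isog G H -> C G -> C H) /\
  (forall G (S : {set vert G}), S != set0 -> C G -> C (induced S)).

Definition is_max_rho1 (R : realType) (C : sgraph -> Prop) (s : nat) (a : R) :
    Prop :=
  (exists H, [/\ C H, gorder H = s & rho R 1 H = a]) /\
  (forall H, C H -> gorder H = s -> rho R 1 H <= a).

(* H is a starred graph H^*(s). *)
Definition extremal (R : realType) (C : sgraph -> Prop) (alpha : nat -> R)
    (s : nat) (H : sgraph) : Prop :=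
  [/\ C H, gorder H = s & rho R 1 H = alpha s].

(* Main.v *)
(* If u and v are orthogonal eigenvectors for rho_1 and rho_2, then either one
   of them changes sign, and its positive and negative parts f, g satisfy
   f^T A f >= rho_2 |f|^2 + f^T A g and likewise for g, or both have constant
   sign and are then disjointly supported, with f^T A g = 0. In each case the
   supports S, T of f, g are disjoint and rho_1(G[S]), rho_1(G[T]) >= rho_2, so
   the smaller of the two gives rho_2 <= alpha(floor(n/2)). In case of equality
   f^T A g = 0, so no edge joins S and T, and counting vertices leaves at most
   one vertex w outside S and T. Strict monotonicity of alpha forces G[S] and
   G[T] to be connected, so G is connected as soon as w meets both. *)
Require Import Defs.
From mathcomp Require Import all_boot all_order all_algebra.
From mathcomp Require Import perm polyrcf complex reals.
From mathcomp Require Import ring lra zify.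

Set Implicit Arguments.
Unset Strict Implicit.
Unset Printing Implicit Defensive.

Import Order.TTheory GRing.Theory Num.Theory.
Local Open Scope ring_scope.

(** * Orthogonal diagonalization of real symmetric matrices *)

Lemma sum_sqr_eq0 (R : realDomainType) (T : finType) (f : T -> R) :
  \sum_x f x ^+ 2 = 0 -> f =1 (fun=> 0).
Proof.
move=> f0 x; apply/eqP; rewrite -sqrf_eq0; apply/eqP.
exact: (psumr_eq0P (fun y _ => sqr_ge0 (f y)) f0).
Qed.

Lemma row_dotE (R : comPzRingType) n (u v : 'rV[R]_n) :
  (u *m v^T) 0 0 = \sum_j u 0 j * v 0 j.
Proof. by rewrite mxE; apply: eq_bigr => j _; rewrite mxE. Qed.

Lemma row_norm_eq0 (R : realDomainType) n (v : 'rV[R]_n) :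
  ((v *m v^T) 0 0 == 0) = (v == 0).
Proof.
apply/eqP/eqP => [|->]; last by rewrite mul0mx mxE.
rewrite row_dotE (eq_bigr _ (fun j _ => esym (expr2 _))) => /sum_sqr_eq0 v0.
by apply/rowP => j; rewrite v0 mxE.
Qed.

Lemma row_norm_ge0 (R : realDomainType) n (v : 'rV[R]_n) :
  0 <= (v *m v^T) 0 0.
Proof. by rewrite row_dotE sumr_ge0 // => j _; rewrite -expr2 sqr_ge0. Qed.

Lemma row_dotC (R : comPzRingType) n (u v : 'rV[R]_n) :
  (u *m v^T) 0 0 = (v *m u^T) 0 0.
Proof. by rewrite !row_dotE; apply: eq_bigr => j _; rewrite mulrC. Qed.

Lemma row_dot_linearl (R : comPzRingType) n (a b : R) (u v w : 'rV[R]_n) :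
  ((a *: u + b *: v) *m w^T) 0 0 = a * (u *m w^T) 0 0 + b * (v *m w^T) 0 0.
Proof. by rewrite mulmxDl -!scalemxAl !mxE. Qed.

(* A complex eigenvector [a + i b] for [s + i t] satisfies
   [t (|a|^2 + |b|^2) = 0] by symmetry of [A]. *)
Lemma sym_real_eigenvector (R : rcfType) n (A : 'M[R]_n) :
  (0 < n)%N -> A^T = A -> exists l, exists2 v : 'rV[R]_n, v *m A = l *: v & v != 0.
Proof.
move=> n_gt0 symA.
have [z /eigenvalueP[v vA v_neq0]] :=
  eigenvalue_closed (map_mx (real_complex R) A) n_gt0.
pose a := map_mx (@complex.Re R) v; pose b := map_mx (@complex.Im R) v.
pose s := complex.Re z; pose t := complex.Im z.
have E j : \sum_k v 0 k * (A k j)%:C%C = z * v 0 j.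
  move/rowP: vA => /(_ j); rewrite !mxE => <-.
  by apply: eq_bigr => k _; rewrite mxE.
have aA : a *m A = s *: a + (- t) *: b.
  apply/rowP => j; rewrite !mxE; move: (congr1 (@complex.Re R) (E j)).
  rewrite raddf_sum /=; case: (v 0 j) {E} => x y /=; rewrite /s /t mulNr.
  case: (z) => z1 z2 /= <-; apply: eq_bigr => k _.
  by rewrite mxE; case: (v 0 k) => p q /=; rewrite mulr0 subr0.
have bA : b *m A = t *: a + s *: b.
  apply/rowP => j; rewrite !mxE; move: (congr1 (@complex.Im R) (E j)).
  rewrite raddf_sum /=; case: (v 0 j) {E} => x y /=; rewrite /s /t.
  case: (z) => z1 z2 /= E; rewrite addrC -E; apply: eq_bigr => k _.
  by rewrite mxE; case: (v 0 k) => p q /=; rewrite mulr0 add0r.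
have ab0 : ~~ ((a == 0) && (b == 0)).
  apply: contra v_neq0 => /andP[/eqP/rowP a0 /eqP/rowP b0].
  apply/eqP/rowP => j; move: (a0 j) (b0 j); rewrite !mxE.
  by case: (v 0 j) => x y /= -> ->.
have t0 : t = 0.
  have : ((a *m A) *m b^T) 0 0 = ((b *m A) *m a^T) 0 0.
    by rewrite row_dotC trmx_mul symA mulmxA.
  rewrite aA bA !row_dot_linearl (row_dotC b a) => eq_t.
  have {eq_t} /eqP : t * ((a *m a^T) 0 0 + (b *m b^T) 0 0) = 0 by lra.
  rewrite mulf_eq0 paddr_eq0 ?row_norm_ge0 // !row_norm_eq0 (negPf ab0) orbF.
  by move/eqP.
(* With [t = 0], both [a] and [b] satisfy the real eigenvector equation for [s]; either nonzero one
   serves. *)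
have [a0|a_neq0] := eqVneq a 0.
  exists s, b; first by rewrite bA a0 scaler0 add0r.
  by apply: contra ab0 => ->; rewrite a0 eqxx.
by exists s, a; rewrite // aA t0 oppr0 scale0r addr0.
Qed.

(* The Householder reflection exchanging [v] and the first basis vector. *)
Lemma orthogonal_with_first_row (R : realFieldType) n (v : 'rV[R]_n.+1) :
  (v *m v^T) 0 0 = 1 ->
  exists H : 'M[R]_n.+1, [/\ H^T = H, H *m H = 1%:M & delta_mx 0 0 *m H = v].
Proof.
move=> v1; set e : 'rV[R]_n.+1 := delta_mx 0 0.
have [->|neq] := eqVneq v e.
  by exists 1%:M; rewrite trmx1 !mulmx1.
have e1 : (e *m e^T) 0 0 = 1.
  by rewrite /e trmx_delta mul_delta_mx mxE.
have [w wE] : exists w, w = 1 *: v + (- 1) *: e by eexists.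
have [q qE] : exists q, q = (w *m w^T) 0 0 by eexists.
have q0 : q != 0 by rewrite qE row_norm_eq0 wE scale1r scaleN1r subr_eq0.
have wq : w *m w^T = q%:M by rewrite [LHS]mx11_scalar qE.
have ewE : (e *m w^T) 0 0 = (e *m v^T) 0 0 - 1.
  by rewrite row_dotC wE row_dot_linearl e1 row_dotC mul1r mulN1r.
(* As [v] and [e] both have norm 1, [|v - e|^2 = 2 - 2 (e.v) = -2 (e.w)]. This is what makes the
   reflection along [w] send [e] to [e + w = v]. *)
have {}qE : q = - 2 * (e *m w^T) 0 0.
  rewrite ewE qE {1}wE row_dot_linearl ewE row_dotC wE row_dot_linearl v1; ring.
have ew0 : (e *m w^T) 0 0 != 0.
  by apply: contra q0; rewrite qE => /eqP ->; rewrite mulr0.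
exists (1%:M - (2 / q) *: (w^T *m w)); split.
- by rewrite linearB linearZ /= trmx1 trmx_mul trmxK.
- rewrite mulmxBl mul1mx mulmxBr mulmx1 -!scalemxAl -!scalemxAr.
  rewrite mulmxA -(mulmxA w^T) wq mul_mx_scalar -scalemxAl !scalerA.
  rewrite -addrA -opprD -[RHS]addr0; congr (_ + _).
  by rewrite -scalerBl -scalerDl (_ : _ + _ = 0) ?scale0r ?oppr0 //; field.
- rewrite mulmxBr mulmx1 -scalemxAr mulmxA [e *m w^T]mx11_scalar mul_scalar_mx.
  rewrite scalerA (_ : 2 / q * _ = -1) ?scaleN1r ?opprK; last by rewrite qE; field.
  by rewrite wE scale1r scaleN1r addrC subrK.
Qed.

(** Induction on the size. A reflection [H] takes the first basis vector to a unit eigenvector, so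
    the first row of [H A H] is zero off the diagonal, and by symmetry so is the first column. The
    remaining block is symmetric and is diagonalized by some [Q]; then [P] is [diag(1, Q) H]. *)
Theorem sym_orthogonal_diag (R : rcfType) n (A : 'M[R]_n) :
  A^T = A ->
  exists P : 'M[R]_n, exists2 d : 'rV[R]_n,
    P *m P^T = 1%:M & P *m A = diag_mx d *m P.
Proof.
elim: n A => [|n IHn] A symA.
  by exists 1%:M, 0; rewrite ?trmx1 ?mulmx1 //; apply/matrixP => [[]].
have [l [v vA v_neq0]] := sym_real_eigenvector (ltn0Sn n) symA.
wlog v1 : v vA v_neq0 / (v *m v^T) 0 0 = 1.
  set q := (v *m v^T) 0 0.
  have q_gt0 : 0 < q by rewrite lt_def row_norm_eq0 v_neq0 row_norm_ge0.
  move=> /(_ ((Num.sqrt q)^-1 *: v)); apply.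
  - by rewrite -scalemxAl vA !scalerA mulrC.
  - by rewrite scaler_eq0 negb_or v_neq0 invr_eq0 sqrtr_eq0 -ltNge q_gt0.
  - rewrite linearZ /= -scalemxAl -scalemxAr scalerA mxE -/q -expr2 exprVn.
    by rewrite sqr_sqrtr ?ltW // mulVf ?gt_eqF.
have [H [symH HH eH]] := orthogonal_with_first_row v1.
have symB : (H *m A *m H)^T = H *m A *m H by rewrite !trmx_mul symA symH mulmxA.
have row0B : delta_mx 0 0 *m (H *m A *m H) = l *: delta_mx (0 : 'I_1) 0.
  rewrite -mulmxA mulmxA eH mulmxA vA -scalemxAl -eH -mulmxA HH.
  by rewrite mulmx1.
have HA : H *m A = (H *m A *m H) *m H by rewrite -(mulmxA (H *m A)) HH mulmx1.
have B0 j : (H *m A *m H) 0 j = l *+ (j == 0).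
  have /rowP/(_ j) := row0B; rewrite -rowE !mxE eqxx /= => ->.
  by rewrite mulr_natr.
(* The conjugate is abstracted and retyped at size [1 + n], which gives access to its blocks. *)
have {symB B0 HA} [B [symB B0 HA]] : exists B : 'M[R]_(1 + n),
    [/\ B^T = B, forall j, B 0 j = l *+ (j == 0) & H *m A = B *m H].
  by exists (H *m A *m H).
have symD : (drsubmx B)^T = drsubmx B by rewrite trmx_drsub symB.
have [Q [d QQ QD]] := IHn _ symD.
have Bdef : B = block_mx l%:M 0 0 (drsubmx B).
  rewrite -[LHS]submxK; congr block_mx.
  - rewrite [LHS]mx11_scalar !mxE; congr _%:M.
    have -> : lshift n 0 = 0 :> 'I_(1 + n) by apply/val_inj.
    by rewrite B0.
  - apply/rowP => j; rewrite !mxE.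
    have -> : lshift n 0 = 0 :> 'I_(1 + n) by apply/val_inj.
    by rewrite B0.
  - apply/colP => j; rewrite -symB !mxE.
    have -> : lshift n 0 = 0 :> 'I_(1 + n) by apply/val_inj.
    by rewrite B0.
pose K : 'M[R]_(1 + n) := block_mx 1%:M 0 0 Q.
have KK : K *m K^T = 1%:M.
  rewrite /K tr_block_mx mulmx_block !trmx0 !mul0mx !mulmx0 !addr0 add0r.
  by rewrite trmx1 mulmx1 QQ -scalar_mx_block.
have KB : K *m B = diag_mx (row_mx l%:M d) *m K.
  rewrite Bdef /K diag_mx_row !mulmx_block !mul0mx !mulmx0 !addr0 !add0r QD.
  congr block_mx; rewrite mul1mx mulmx1; apply/matrixP => i j.
  by rewrite !ord1 !mxE.
exists (K *m H), (row_mx l%:M d).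
  by rewrite trmx_mul symH mulmxA -(mulmxA K) HH mulmx1.
by rewrite -mulmxA HA mulmxA KB mulmxA.
Qed.

(** Over polynomials, [P (X - A) = (X - D) P] with [D] diagonal. Taking determinants, the nonzero
    factor [det P] cancels. *)
Lemma orthogonal_diag_char_poly (R : fieldType) n (A P : 'M[R]_n) (d : 'rV[R]_n) :
  P *m P^T = 1%:M -> P *m A = diag_mx d *m P ->
  char_poly A = \prod_(x <- [seq d 0 i | i : 'I_n]) ('X - x%:P).
Proof.
move=> PP PA; have [Punit _] := mulmx1_unit PP.
have detP : \det (map_mx polyC P) != 0.
  by rewrite det_map_mx polyC_eq0 -unitfE -unitmxE.
have char_mxP : map_mx polyC P *m char_poly_mx A =
    char_poly_mx (diag_mx d) *m map_mx polyC P.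
  rewrite /char_poly_mx mulmxBr mulmxBl -!map_mxM PA.
  by rewrite mul_mx_scalar mul_scalar_mx.
have /(congr1 determinant) := char_mxP; rewrite !det_mulmx mulrC.
move/(mulIf detP); rewrite -/(char_poly A) -/(char_poly (diag_mx d)) => ->.
rewrite char_poly_trig ?diag_mx_is_trig // big_map big_enum /=.
by apply: eq_bigr => i _; rewrite mxE eqxx.
Qed.

(** * The spectrum of a graph and its orthonormal eigenfunctions *)

(** Both lists contain each [x] as often as its multiplicity as a root of [p]. This identifies
    [spectrum] with the diagonal entries of any orthogonal diagonalization, up to order. *)
Lemma perm_mup_roots (R : rcfType) (s : seq R) (p := \prod_(x <- s) ('X - x%:P)) :
  perm_eq (flatten [seq nseq (mup x p) x | x <- rev (rootsR p)]) s.
Proof.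
have p0 : p != 0 by rewrite monic_neq0 ?monic_prod_XsubC.
apply/allP => x _ /=; rewrite count_flatten -map_comp map_rev sumn_rev sumnE.
rewrite big_map (eq_bigr (fun y => if y == x then count_mem x s else 0%N)); last first.
  move=> y _ /=; rewrite count_nseq /= mu_prod_XsubC.
  by case: eqP => [->|]; rewrite ?mul1n ?mul0n.
have rE : (x \in rootsR p) = (x \in s).
  by rewrite -(roots_on_rootsR p0) root_prod_XsubC.
have [xr|xr] := boolP (x \in rootsR p).
  rewrite (bigD1_seq x) ?uniq_roots //= eqxx big1 ?addn0 // => y.
  by move=> /negPf ->.
rewrite big_seq big1 => [|y yr]; last by case: eqP yr xr => // -> ->.
by rewrite (count_memPn _) // -rE.
Qed.

Lemma pairwise_ge_flatten_nseq (R : realDomainType) (m : R -> nat) (s : seq R) :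
  pairwise >%R s -> pairwise >=%R (flatten [seq nseq (m x) x | x <- s]).
Proof.
elim: s => //= x s IHs /andP[/allP x_gt /IHs IH].
rewrite pairwise_cat IH andbT; apply/andP; split.
  apply/allrelP => y z /nseqP[-> _] /flattenP[_ /mapP[t ts ->]] /nseqP[-> _].
  by apply/ltW/x_gt.
elim: (m x) => //= k ->; rewrite andbT; apply/allP => y /nseqP[-> _].
exact: lexx.
Qed.

Lemma adjmx_sym (R : realType) G : (adjmx R G)^T = adjmx R G.
Proof. by apply/matrixP => i j; rewrite !mxE edge_sym. Qed.

(** The [e i] are the rows of the diagonalizing matrix, permuted so that their eigenvalues follow
    the order of [spectrum]. Orthonormality of the rows gives the first relation; that of the
    columns gives the second, which allows expansion in the [e i]. *)
Lemma spectral_basis (R : realType) (G : sgraph) :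
  size (spectrum R G) = gorder G /\
  exists e : 'I_(gorder G) -> vert G -> R,
  [/\ forall i j, \sum_x e i x * e j x = (i == j)%:R,
      forall x y, \sum_i e i x * e i y = (x == y)%:R
    & forall i x, \sum_y (edge x y)%:R * e i y = (spectrum R G)`_i * e i x].
Proof.
have [P [d PP PA]] := sym_orthogonal_diag (adjmx_sym R G).
have P'P : P^T *m P = 1%:M by apply: mulmx1C.
have := perm_mup_roots [seq d 0 i | i : 'I_(gorder G)].
rewrite -(orthogonal_diag_char_poly PP PA) -/(spectrum R G) => pE.
have szE : size (spectrum R G) = gorder G.
  by rewrite (perm_size pE) size_map -cardE card_ord.
split=> //.
have pE' : perm_eq (spectrum R G) [tuple d 0 i | i < gorder G].
  exact: pE.
have /tuple_permP[s sE] := pE'.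
have sE' (i : 'I_(gorder G)) : (spectrum R G)`_i = d 0 (s i).
  by rewrite sE -tnth_nth tnth_mktuple tnth_mktuple.
exists (fun i x => P (s i) (enum_rank x)); split=> [i j|x y|i x].
- rewrite -(inj_eq (@perm_inj _ s)).
  move/matrixP: PP => /(_ (s i) (s j)); rewrite !mxE => <-.
  rewrite [RHS](reindex (@enum_rank (vert G))) /=; last exact/onW_bij/enum_rank_bij.
  by apply: eq_bigr => k _; rewrite mxE.
- rewrite -(inj_eq (@enum_rank_inj (vert G))).
  move/matrixP: P'P => /(_ (enum_rank x) (enum_rank y)); rewrite !mxE => <-.
  rewrite [RHS](reindex_inj (@perm_inj _ s)) /=.
  by apply: eq_bigr => k _; rewrite mxE.
- rewrite sE'; move/matrixP: PA => /(_ (s i) (enum_rank x)).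
  rewrite mul_diag_mx !mxE => <-.
  rewrite [RHS](reindex (@enum_rank (vert G))) /=; last exact/onW_bij/enum_rank_bij.
  by apply: eq_bigr => k _; rewrite !mxE !enum_rankK mulrC edge_sym.
Qed.

Lemma spectrum_ge (R : realType) (G : sgraph) i j :
  (i <= j < gorder G)%N -> (spectrum R G)`_j <= (spectrum R G)`_i.
Proof.
move=> /andP[ij jn]; have [sz _] := spectral_basis R G.
have: pairwise >=%R (spectrum R G).
  apply: pairwise_ge_flatten_nseq; rewrite -sorted_pairwise.
    by rewrite rev_sorted; apply: sorted_roots.
  by move=> x y z xy yz; apply: lt_trans yz xy.
move: ij; rewrite leq_eqVlt => /predU1P[-> //|ij] /(pairwiseP 0); apply=> //.
  by rewrite inE sz (ltn_trans ij).
by rewrite inE sz.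
Qed.

(** * Quadratic forms and the two largest eigenvalues *)

Definition dotf (R : realType) (T : finType) (f g : T -> R) : R :=
  \sum_x f x * g x.

Definition adjform (R : realType) (G : sgraph) (f g : vert G -> R) : R :=
  \sum_x f x * (\sum_y (edge x y)%:R * g y).

Definition eigenfun (R : realType) (G : sgraph) (l : R) (f : vert G -> R) : Prop :=
  forall x, \sum_y (edge x y)%:R * f y = l * f x.

Section Forms.
Variable R : realType.

Lemma dotfC (T : finType) (f g : T -> R) : dotf f g = dotf g f.
Proof. by apply: eq_bigr => x _; rewrite mulrC. Qed.

Lemma dotf_linearr (T : finType) (s t : R) (f g h : T -> R) :
  dotf h (fun x => s * f x + t * g x) = s * dotf h f + t * dotf h g.
Proof.
rewrite /dotf !mulr_sumr -big_split; apply: eq_bigr => x _ /=; ring.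
Qed.

Lemma dotff_ge0 (T : finType) (f : T -> R) : 0 <= dotf f f.
Proof. by apply: sumr_ge0 => x _; rewrite -expr2 sqr_ge0. Qed.

Lemma dotff_gt0 (T : finType) (f : T -> R) x : f x != 0 -> 0 < dotf f f.
Proof.
move=> fx; rewrite lt_def dotff_ge0 andbT; apply: contra fx => /eqP f0.
apply/eqP; apply: sum_sqr_eq0 x.
by rewrite -[RHS]f0; apply: eq_bigr => x _; rewrite expr2.
Qed.

Lemma dotff_neq0 (T : finType) (f : T -> R) : 0 < dotf f f -> exists x, f x != 0.
Proof.
move=> f_gt0; apply/existsP; apply: contraLR f_gt0 => /existsPn f0.
rewrite -leNgt /dotf big1 // => x _.
by move/negbNE/eqP: (f0 x) => ->; rewrite mul0r.
Qed.

Variable G : sgraph.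
Implicit Types f g h : vert G -> R.

Lemma adjformC f g : adjform f g = adjform g f.
Proof.
rewrite /adjform; under eq_bigr do rewrite mulr_sumr.
rewrite exchange_big; apply: eq_bigr => y _ /=; rewrite mulr_sumr.
by apply: eq_bigr => x _; rewrite edge_sym mulrCA [f x * _]mulrC mulrCA.
Qed.

Lemma adjform_linearr s t f g h :
  adjform h (fun x => s * f x + t * g x) = s * adjform h f + t * adjform h g.
Proof.
rewrite /adjform !mulr_sumr -big_split; apply: eq_bigr => x _ /=.
have -> : \sum_y (edge x y)%:R * (s * f y + t * g y) =
    s * (\sum_y (edge x y)%:R * f y) + t * \sum_y (edge x y)%:R * g y.
  by rewrite !mulr_sumr -big_split; apply: eq_bigr => y _ /=; ring.
ring.
Qed.

Lemma adjform_eigenfun l f g : eigenfun l f -> adjform g f = l * dotf g f.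
Proof.
move=> fl; rewrite /adjform /dotf mulr_sumr; apply: eq_bigr => x _.
by rewrite fl mulrCA.
Qed.

Lemma eq_adjform f f' g g' : f =1 f' -> g =1 g' -> adjform f g = adjform f' g'.
Proof.
move=> ff' gg'; apply: eq_bigr => x _; rewrite ff'; congr (_ * _).
by apply: eq_bigr => y _; rewrite gg'.
Qed.

Lemma adjform_ge0 f g :
  (forall x, 0 <= f x) -> (forall x, 0 <= g x) -> 0 <= adjform f g.
Proof.
move=> f0 g0; apply: sumr_ge0 => x _; apply: mulr_ge0 => //.
by apply: sumr_ge0 => y _; apply: mulr_ge0.
Qed.

(** The form is a sum of nonnegative terms, so its vanishing kills the term of every pair [x],
    [y]. *)
Lemma adjform_eq0_nonadj f g x y :
  (forall x, 0 <= f x) -> (forall x, 0 <= g x) -> adjform f g = 0 ->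
  0 < f x -> 0 < g y -> ~~ edge x y.
Proof.
move=> f0 g0 fg0 fx gy.
have inner_ge0 z : 0 <= \sum_y (edge z y)%:R * g y.
  by apply: sumr_ge0 => w _; apply: mulr_ge0.
have /eqP := psumr_eq0P (fun z _ => mulr_ge0 (f0 z) (inner_ge0 z)) fg0 (i := x) isT.
rewrite mulf_eq0 gt_eqF //= => /eqP gx0.
have := psumr_eq0P (fun w _ => mulr_ge0 (ler0n R (edge x w)) (g0 w)) gx0 (i := y) isT.
by move/eqP; rewrite mulf_eq0 (gt_eqF gy) orbF pnatr_eq0 eqb0.
Qed.

End Forms.

(** In the eigenbasis the adjacency form is the sum of the squared coefficients weighted by the
    eigenvalues. The largest eigenvalue bounds every weight, and the second one suffices once the
    coefficient along [u] is zero. *)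
Lemma rayleigh (R : realType) (G : sgraph) :
  (0 < gorder G)%N ->
  exists u v : vert G -> R,
  [/\ forall f : vert G -> R, adjform f f <= rho R 1 G * dotf f f,
      forall f : vert G -> R, dotf u f = 0 -> adjform f f <= rho R 2 G * dotf f f,
      eigenfun (rho R 1 G) u, 0 < dotf u u
    & (1 < gorder G)%N ->
      [/\ eigenfun (rho R 2 G) v, 0 < dotf v v, dotf u v = 0
        & rho R 2 G <= rho R 1 G]].
Proof.
move=> n_gt0; have [_ [e [ortho compl eig]]] := spectral_basis R G.
pose c (f : vert G -> R) i := dotf (e i) f.
have expand (f : vert G -> R) x : f x = \sum_i c f i * e i x.
  transitivity (\sum_y f y * \sum_i e i y * e i x).
    rewrite (bigD1 x) //= compl eqxx mulr1 big1 ?addr0 // => y /negPf yx.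
    by rewrite compl yx mulr0.
  under eq_bigr => y _ do rewrite mulr_sumr.
  rewrite exchange_big; apply: eq_bigr => i _ /=; rewrite /c /dotf mulr_suml.
  by apply: eq_bigr => y _; ring.
have dotE (f : vert G -> R) : dotf f f = \sum_i c f i ^+ 2.
  rewrite {1}/dotf; under eq_bigr => x _ do rewrite {2}(expand f x) mulr_sumr.
  rewrite exchange_big /=; apply: eq_bigr => i _; rewrite expr2 [X in _ = _ * X]/c /dotf mulr_sumr.
  by apply: eq_bigr => x _; ring.
have formE (f : vert G -> R) : adjform f f = \sum_(i < gorder G) (spectrum R G)`_i * c f i ^+ 2.
  rewrite /adjform.
  have Af x : \sum_y (edge x y)%:R * f y =
      \sum_(i < gorder G) c f i * ((spectrum R G)`_i * e i x).
    under eq_bigr => y _ do rewrite (expand f y) mulr_sumr.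
    rewrite exchange_big /=; apply: eq_bigr => i _; rewrite -eig mulr_sumr.
    by apply: eq_bigr => y _; ring.
  under eq_bigr => x _ do rewrite Af mulr_sumr.
  rewrite exchange_big /=; apply: eq_bigr => i _.
  rewrite expr2 [X in _ = _ * (_ * X)]/c /dotf !mulr_sumr.
  by apply: eq_bigr => x _; ring.
pose i0 := Ordinal n_gt0.
have dot_gt0 i : 0 < dotf (e i) (e i) by rewrite /dotf ortho eqxx.
(* In order 1, [rho R 2 G] is only a default value. The second bound still holds because a function
   orthogonal to [u] has no other coefficient, and [v] is a dummy. *)
have [n_gt1|n_le1] := ltnP 1 (gorder G); last first.
  exists (e i0), (e i0); split => // [f|f f0].
  - rewrite formE dotE mulr_sumr; apply: ler_sum => i _.
    by rewrite ler_wpM2r ?sqr_ge0 // spectrum_ge //=.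
  - rewrite formE dotE mulr_sumr; apply: ler_sum => i _.
    have -> : i = i0 by apply/val_inj => /=; have := ltn_ord i; lia.
    by rewrite /c f0 expr0n !mulr0.
exists (e i0), (e (Ordinal n_gt1)); split => // [f|f f0|_].
- rewrite formE dotE mulr_sumr; apply: ler_sum => i _.
  by rewrite ler_wpM2r ?sqr_ge0 // spectrum_ge //=.
- rewrite formE dotE mulr_sumr; apply: ler_sum => i _.
  have [->|i_neq0] := eqVneq i i0; first by rewrite /c f0 expr0n !mulr0.
  rewrite ler_wpM2r ?sqr_ge0 // spectrum_ge //= ltn_ord andbT lt0n.
  by apply: contra i_neq0 => /eqP i0E; apply/eqP/val_inj.
split=> //; first by rewrite /dotf ortho.
exact: spectrum_ge.
Qed.

Lemma rho1_attained (R : realType) (G : sgraph) :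
  (0 < gorder G)%N ->
  exists2 u : vert G -> R, 0 < dotf u u & adjform u u = rho R 1 G * dotf u u.
Proof.
move=> /(@rayleigh R)[u [v [_ _ eigu u_gt0 _]]]; exists u => //.
exact: adjform_eigenfun.
Qed.

Lemma adjform_le_rho1 (R : realType) (G : sgraph) (f : vert G -> R) :
  adjform f f <= rho R 1 G * dotf f f.
Proof.
have [/card0_eq G0|/(@rayleigh R)[u [v [-> //]]]] := posnP (gorder G).
by rewrite /adjform /dotf !big1 ?mulr0 // => x; have := G0 x.
Qed.

(** The Courant-Fischer argument: the span of [f] and [g] contains a nonzero [h] orthogonal to the
    top eigenfunction, and as both cross terms vanish, the Rayleigh quotient of [h] is at least
    [a]. *)
Lemma le_rho2 (R : realType) (G : sgraph) (a : R) (f g : vert G -> R) :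
  0 < dotf f f -> 0 < dotf g g -> dotf f g = 0 -> adjform f g = 0 ->
  a * dotf f f <= adjform f f -> a * dotf g g <= adjform g g -> a <= rho R 2 G.
Proof.
move=> f_gt0 g_gt0 fg0 Afg0 af ag.
have [x0 _] := dotff_neq0 f_gt0.
have n_gt0 : (0 < gorder G)%N by apply/card_gt0P; exists x0.
have [u [_ [_ ray2 _ _ _]]] := rayleigh R n_gt0.
suff [s [t [uh st]]] : exists s t : R,
    s * dotf u f + t * dotf u g = 0 /\ (s != 0) || (t != 0).
  pose h x := s * f x + t * g x.
  have hh : dotf h h = s ^+ 2 * dotf f f + t ^+ 2 * dotf g g.
    rewrite dotf_linearr ![dotf h _]dotfC !dotf_linearr [dotf g f]dotfC fg0; ring.
  have Ahh : adjform h h = s ^+ 2 * adjform f f + t ^+ 2 * adjform g g.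
    rewrite adjform_linearr ![adjform h _]adjformC !adjform_linearr.
    rewrite [adjform g f]adjformC Afg0; ring.
  have /ray2 le_h : dotf u h = 0 by rewrite dotf_linearr.
  have h_gt0 : 0 < dotf h h.
    have sq_gt0 z : z != 0 -> 0 < z ^+ 2 :> R by move=> z0; rewrite exprn_even_gt0.
    rewrite hh; case/orP: st => /sq_gt0 nz; [apply: ltr_pwDl | apply: ltr_pwDr];
      by [apply: mulr_gt0 | apply: mulr_ge0; rewrite ?sqr_ge0 ?dotff_ge0].
  rewrite -(ler_pM2r h_gt0); apply: le_trans le_h.
  by rewrite Ahh hh mulrDr; apply: lerD; rewrite mulrCA ler_wpM2l ?sqr_ge0.
(* If [f] is already orthogonal to [u], take [h = f]. Otherwise the coefficients [u.g] and [-(u.f)]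
   cancel the component along [u], and the second one is nonzero. *)
have [uf0|uf0] := eqVneq (dotf u f) 0.
  by exists 1, 0; rewrite uf0 mulr0 mul0r addr0 oner_eq0.
exists (dotf u g), (- dotf u f); rewrite oppr_eq0 uf0 orbT; split=> //; ring.
Qed.

(** * Two disjointly supported functions certifying the second eigenvalue *)

Definition posf (R : realType) (T : finType) (f : T -> R) (x : T) : R :=
  Num.max 0 (f x).

(** The term [adjform f g] is kept in the bounds although it is nonnegative: in the equality case it
    must vanish, which rules out edges between the supports. *)
Lemma second_eigenvalue_split (R : realType) (G : sgraph) :
  (1 < gorder G)%N ->
  exists f g : vert G -> R,
  [/\ forall x, [/\ 0 <= f x, 0 <= g x & f x * g x = 0],
      0 < dotf f f, 0 < dotf g g,
      rho R 2 G * dotf f f + adjform f g <= adjform f f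
    & rho R 2 G * dotf g g + adjform f g <= adjform g g].
Proof.
move=> n_gt1.
have [u [v [_ _ eigu u_gt0 /(_ n_gt1)[eigv v_gt0 uv0 rho_le]]]] :=
  rayleigh R (ltnW n_gt1).
(* Write [w = f - g] with its positive and negative parts. Pairing the eigenvalue equation with [f]
   gives [l f.f = fAf - fAg], and pairing it with [g] gives [l g.g = gAg - fAg]. Only [l >= rho_2]
   is needed, so this covers both [u] and [v]. *)
have signed_split l (w : vert G -> R) : eigenfun l w -> rho R 2 G <= l ->
    (exists x, 0 < w x) -> (exists x, w x < 0) ->
    exists f g : vert G -> R,
    [/\ forall x, [/\ 0 <= f x, 0 <= g x & f x * g x = 0],
        0 < dotf f f, 0 < dotf g g,
        rho R 2 G * dotf f f + adjform f g <= adjform f f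
      & rho R 2 G * dotf g g + adjform f g <= adjform g g].
  move=> eigw rho_l [x wx] [y wy].
  exists (posf w), (posf (fun x => - w x)).
  set f := posf w; set g := posf _.
  have wE z : w z = 1 * f z + (- 1) * g z.
    by rewrite /f /g /posf; case: (ltrgtP 0 (w z)); case: (ltrgtP 0 (- w z)); lra.
  have fg0 z : f z * g z = 0.
    rewrite /f /g /posf.
    by case: (ltrgtP 0 (w z)); case: (ltrgtP 0 (- w z));
       rewrite ?mulr0 ?mul0r //; lra.
  have dfg : dotf f g = 0 by rewrite /dotf big1.
  have f_gt0 : 0 < dotf f f.
    by apply: (@dotff_gt0 _ _ _ x); rewrite /f /posf; case: ltrgtP wx; lra.
  have g_gt0 : 0 < dotf g g.
    apply: (@dotff_gt0 _ _ _ y); rewrite /g /posf.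
    by case: (ltrgtP 0 (- w y)); lra.
  have dotE h : dotf h w = dotf h f - dotf h g.
    rewrite -[X in _ = X - _]mul1r -mulN1r -dotf_linearr.
    by apply: eq_bigr => z _; rewrite wE.
  have formE h : l * dotf h w = adjform h f - adjform h g.
    rewrite -(adjform_eigenfun _ eigw) -[X in _ = X - _]mul1r -mulN1r.
    by rewrite -adjform_linearr; apply: eq_adjform.
  have ff := formE f; have gg := formE g.
  rewrite !dotE dfg subr0 in ff.
  rewrite dotE dotfC dfg sub0r (adjformC g f) in gg.
  have := ler_wpM2r (ltW f_gt0) rho_l; have := ler_wpM2r (ltW g_gt0) rho_l.
  split=> // [z||]; [|lra|lra].
  by split; rewrite // /f /g /posf le_max lexx.
have eigen_scale l s (w : vert G -> R) :
    eigenfun l w -> eigenfun l (fun x => s * w x).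
  move=> eigw x; rewrite mulrCA -eigw mulr_sumr.
  by apply: eq_bigr => y _; rewrite mulrCA.
have [/andP[/existsP[x wx] /existsP[y wy]]|u_sign] :=
    boolP ([exists x, 0 < u x] && [exists x, u x < 0]).
  by apply: signed_split eigu rho_le _ _; [exists x | exists y].
have [/andP[/existsP[x wx] /existsP[y wy]]|v_sign] :=
    boolP ([exists x, 0 < v x] && [exists x, v x < 0]).
  by apply: signed_split eigv (lexx _) _ _; [exists x | exists y].
have constant_sign (w : vert G -> R) :
    ~~ ([exists x, 0 < w x] && [exists x, w x < 0]) ->
    exists2 s : R, s * s = 1 & forall x, 0 <= s * w x.
  rewrite negb_and => /orP[/existsPn w_le0|/existsPn w_ge0].
    by exists (-1) => [|x]; [rewrite mulrNN mul1r | rewrite mulN1r oppr_ge0 leNgt].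
  by exists 1 => [|x]; rewrite ?mul1r // leNgt.
have [s ss su] := constant_sign u u_sign.
have [t tt tv] := constant_sign v v_sign.
have dotZ a b (w z : vert G -> R) :
    dotf (fun x => a * w x) (fun x => b * z x) = a * b * dotf w z.
  by rewrite /dotf mulr_sumr; apply: eq_bigr => x _; ring.
(* Neither eigenfunction changes sign, so each can be made nonnegative. Being orthogonal they are
   disjointly supported, and the eigenvalue equation turns this orthogonality into [fAg = 0]. *)
exists (fun x => s * u x), (fun x => t * v x).
have fg0 : dotf (fun x => s * u x) (fun x => t * v x) = 0.
  by rewrite dotZ uv0 mulr0.
rewrite !(adjform_eigenfun _ (eigen_scale _ _ _ eigv)).
rewrite !(adjform_eigenfun _ (eigen_scale _ _ _ eigu)) fg0 !dotZ ss tt !mul1r.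
split=> // [x||].
- split=> //.
  exact: (psumr_eq0P (fun y _ => mulr_ge0 (su y) (tv y)) fg0).
- by rewrite mulr0 addr0 ler_wpM2r // ltW.
- by rewrite mulr0 addr0.
Qed.

(** * Test functions supported on a vertex set *)

Section InducedSubgraphs.
Variables (R : realType) (G : sgraph).
Implicit Types (S T : {set vert G}) (f g : vert G -> R).

Lemma gorder_induced S : gorder (induced S) = #|S|.
Proof. by rewrite /gorder card_sig; apply: eq_card => x; rewrite inE. Qed.

Lemma sum_induced S (F : vert G -> R) :
  (forall x, x \notin S -> F x = 0) ->
  \sum_(z : vert (induced S)) F (val z) = \sum_x F x.
Proof.
move=> F0; rewrite [RHS](bigID (mem S)) /= [X in _ + X]big1 // addr0.
by rewrite [RHS]big_sub.
Qed.

Lemma dotf_induced S f g :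
  (forall x, x \notin S -> f x = 0) ->
  dotf (f \o val : vert (induced S) -> R) (g \o val) = dotf f g.
Proof.
move=> f0; apply: (sum_induced (F := fun x => f x * g x)) => x /f0 ->.
by rewrite mul0r.
Qed.

Lemma adjform_induced S f g :
  (forall x, x \notin S -> f x = 0) -> (forall x, x \notin S -> g x = 0) ->
  adjform (f \o val : vert (induced S) -> R) (g \o val) = adjform f g.
Proof.
move=> f0 g0; rewrite /adjform -(@sum_induced S) => [|x /f0 ->]; last by rewrite mul0r.
apply: eq_bigr => x _ /=; congr (_ * _).
rewrite -(@sum_induced S) => [|y /g0 ->]; last by rewrite mulr0.
by apply: eq_bigr.
Qed.

Lemma le_rho1_induced S f (a : R) :
  (forall x, x \notin S -> f x = 0) -> 0 < dotf f f ->
  a * dotf f f <= adjform f f -> a <= rho R 1 (induced S).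
Proof.
move=> f0 f_gt0 af; rewrite -(ler_pM2r f_gt0); apply: le_trans af _.
rewrite -(adjform_induced f0 f0) -(dotf_induced f f0).
exact: adjform_le_rho1.
Qed.

End InducedSubgraphs.

(** The sets are the supports of the two functions above. Supersets [U] are allowed because a
    function supported in [S] is also a test function for any larger set; this later bounds the
    spectral radius of a full complement. *)
Lemma second_eigenvalue_sets (R : realType) (G : sgraph) :
  (1 < gorder G)%N ->
  exists S T : {set vert G},
  [/\ [/\ S != set0, T != set0 & [disjoint S & T]],
      forall U : {set vert G}, S \subset U -> rho R 2 G <= rho R 1 (induced U),
      forall U : {set vert G}, T \subset U -> rho R 2 G <= rho R 1 (induced U)
    & (rho R 1 (induced S) <= rho R 2 G \/ rho R 1 (induced T) <= rho R 2 G) ->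
      forall x y, x \in S -> y \in T -> ~~ edge x y].
Proof.
move=> /(@second_eigenvalue_split R)[f [g [fg f_gt0 g_gt0 ff gg]]].
have f_ge0 x : 0 <= f x by have [] := fg x.
have g_ge0 x : 0 <= g x by have [] := fg x.
have fg_ge0 : 0 <= adjform f g by apply: adjform_ge0.
pose supp (h : vert G -> R) := [set x | 0 < h x].
have suppN h (U : {set vert G}) x : (forall x, 0 <= h x) ->
    supp h \subset U -> x \notin U -> h x = 0.
  move=> h_ge0 /subsetP hU; apply: contraNeq => hx; apply: hU.
  by rewrite inE lt_def hx h_ge0.
have supp_neq0 h : (forall x, 0 <= h x) -> 0 < dotf h h -> supp h != set0.
  move=> h_ge0 /dotff_neq0[x hx]; apply/set0Pn; exists x.
  by rewrite inE lt_def hx h_ge0.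
exists (supp f), (supp g); split.
- split; [exact: supp_neq0 | exact: supp_neq0 |].
  rewrite disjoint_subset; apply/subsetP => x; rewrite !inE => fx; rewrite -leNgt.
  by have [_ _ /eqP] := fg x; rewrite mulf_eq0 gt_eqF //= => /eqP ->.
- move=> U fU; apply: (le_rho1_induced (f := f)) => //.
    by move=> x; apply: suppN.
  by apply: le_trans ff; rewrite lerDl.
- move=> U gU; apply: (le_rho1_induced (f := g)) => //.
    by move=> x; apply: suppN.
  by apply: le_trans gg; rewrite lerDl.
move=> small x y; rewrite !inE; apply: adjform_eq0_nonadj => //.
(* If, say, [rho_1(G[S]) <= rho_2], then [fAf <= rho_2 f.f], and the lower bound on [fAf] forces
   [fAg <= 0]. *)
apply/eqP; rewrite eq_le fg_ge0 andbT; case: small => le_rho.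
  have f0 z : z \notin supp f -> f z = 0 by apply: suppN.
  have := adjform_le_rho1 (f \o val : vert (induced (supp f)) -> R).
  rewrite adjform_induced // dotf_induced //.
  have := ler_wpM2r (ltW f_gt0) le_rho; lra.
have g0 z : z \notin supp g -> g z = 0 by apply: suppN.
have := adjform_le_rho1 (g \o val : vert (induced (supp g)) -> R).
rewrite adjform_induced // dotf_induced //.
have := ler_wpM2r (ltW g_gt0) le_rho; lra.
Qed.

(** * Transport of functions along graph embeddings *)

Section Pushforward.
Variable R : realType.

(** For injective [h] this is extension by zero along [h]; summing over fibres avoids choosing a
    partial inverse. *)
Definition pushf (A B : finType) (h : A -> B) (u : A -> R) (b : B) : R :=
  \sum_(a | h a == b) u a.

Lemma sum_pushf (A B : finType) (h : A -> B) (u : A -> R) (F : B -> R) :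
  \sum_b F b * pushf h u b = \sum_a F (h a) * u a.
Proof.
rewrite [RHS](partition_big h predT) //=; apply: eq_bigr => b _.
by rewrite mulr_sumr; apply: eq_bigr => a /eqP ->.
Qed.

Lemma dotf_pushf (A1 A2 B : finType) (h1 : A1 -> B) (h2 : A2 -> B) u1 u2 :
  dotf (pushf h1 u1) (pushf h2 u2) =
  \sum_a1 u1 a1 * \sum_(a2 | h2 a2 == h1 a1) u2 a2.
Proof.
rewrite dotfC /dotf sum_pushf.
by apply: eq_bigr => a _; rewrite mulrC.
Qed.

Lemma adjform_pushf (A1 A2 : finType) (G : sgraph) (h1 : A1 -> vert G)
    (h2 : A2 -> vert G) u1 u2 :
  adjform (pushf h1 u1) (pushf h2 u2) =
  \sum_a1 u1 a1 * \sum_a2 (edge (h1 a1) (h2 a2))%:R * u2 a2.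
Proof.
rewrite /adjform; under eq_bigr do rewrite mulrC.
rewrite sum_pushf; apply: eq_bigr => a _; rewrite mulrC; congr (_ * _).
exact: sum_pushf.
Qed.

(** The top eigenfunctions of [G1] and [G2], extended by zero, have disjoint supports with no edge
    between them, so [le_rho2] applies. Vertices outside the two images are unrestricted, which lets
    one statement serve unions, bullets and unions with [K1]. *)
Lemma le_rho2_embed (G G1 G2 : sgraph) (h1 : vert G1 -> vert G)
    (h2 : vert G2 -> vert G) (a : R) :
  injective h1 -> injective h2 -> (forall x y, h1 x != h2 y) ->
  (forall x y, edge (h1 x) (h1 y) = edge x y) ->
  (forall x y, edge (h2 x) (h2 y) = edge x y) ->
  (forall x y, ~~ edge (h1 x) (h2 y)) ->
  (0 < gorder G1)%N -> (0 < gorder G2)%N ->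
  a <= rho R 1 G1 -> a <= rho R 1 G2 -> a <= rho R 2 G.
Proof.
move=> inj1 inj2 h12 e1 e2 e12 /(@rho1_attained R)[u1 u1_gt0 u1E].
move=> /(@rho1_attained R)[u2 u2_gt0 u2E] a1 a2.
have dotE (A B : finType) (h : A -> B) u : injective h ->
    dotf (pushf h u) (pushf h u) = dotf u u.
  move=> inj_h; rewrite dotf_pushf; apply: eq_bigr => x _.
  rewrite (eq_bigl (pred1 x)) ?big_pred1_eq // => y.
  by rewrite /= (inj_eq inj_h).
have formE (H : sgraph) (h : vert H -> vert G) (u : vert H -> R) :
    (forall x y, edge (h x) (h y) = edge x y) ->
    adjform (pushf h u) (pushf h u) = adjform u u.
  move=> eh; rewrite adjform_pushf; apply: eq_bigr => x _; congr (_ * _).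
  by apply: eq_bigr => y _; rewrite eh.
apply: (le_rho2 (f := pushf h1 u1) (g := pushf h2 u2)).
- by rewrite dotE.
- by rewrite dotE.
- rewrite dotf_pushf big1 // => x _; rewrite big1 ?mulr0 // => y.
  by rewrite eq_sym (negPf (h12 x y)).
- rewrite adjform_pushf big1 // => x _; rewrite big1 ?mulr0 // => y _.
  by rewrite (negPf (e12 x y)) mul0r.
- by rewrite dotE // formE // u1E ler_wpM2r // ltW.
- by rewrite dotE // formE // u2E ler_wpM2r // ltW.
Qed.

End Pushforward.

(** * Disjoint unions and one-vertex extensions *)

Lemma isog_sym (G H : sgraph) : isog G H -> isog H G.
Proof.
case=> f [g fK gK] fE; exists g; first by exists f.
by move=> x y; rewrite -fE !gK.
Qed.

Lemma isog_trans (G H K : sgraph) : isog G H -> isog H K -> isog G K.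
Proof.
case=> f bij_f fE [g bij_g gE]; exists (g \o f); first exact: bij_comp.
by move=> x y; rewrite /= gE fE.
Qed.

Lemma connect_homo (A B : finType) (e : rel A) (e' : rel B) (h : A -> B) :
  {homo h : x y / e x y >-> e' x y} ->
  {homo h : x y / connect e x y >-> connect e' x y}.
Proof.
move=> eh x y /connectP[p ep ->]; apply/connectP; exists (map h p).
  by rewrite path_map; apply: sub_path ep => a b; apply: eh.
by rewrite last_map.
Qed.

Lemma connect_edge_sym (G : sgraph) : connect_sym (@edge G).
Proof. by apply: sym_connect_sym; apply: edge_sym. Qed.

Lemma gunion_not_connectedg (G G1 G2 : sgraph) :
  (0 < gorder G1)%N -> (0 < gorder G2)%N -> isog G (gunion G1 G2) ->
  ~ connectedg G.
Proof.
move=> /card_gt0P[x1 _] /card_gt0P[x2 _] [f [g fK gK] fE] [_ conn].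
(* The vertices sent to the left summand form a set that no edge leaves. *)
have clos : closed (@edge G) [pred v | if f v is inl _ then true else false].
  move=> v w; rewrite -fE !inE.
  by case: (f v) => a; case: (f w).
by have := closed_connect clos (conn (g (inl x1)) (g (inr x2))); rewrite !inE !gK.
Qed.

(** The isomorphism is built from the union into [G], where it is just the inclusion of each part,
    and then inverted. *)
Lemma isog_gunion_induced (G : sgraph) (S T : {set vert G}) :
  T = ~: S -> (forall x y, x \in S -> y \in T -> ~~ edge x y) ->
  isog G (gunion (induced S) (induced T)).
Proof.
move=> TE nST; apply: isog_sym.
pose g (z : vert (gunion (induced S) (induced T))) : vert G :=
  match z with inl a => val a | inr b => val b end.
have disj a b : a \in S -> b \in T -> a != b.
  by rewrite TE inE => aS; apply: contraNneq => <-.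
exists g.
  apply: inj_card_bij.
    case=> [a|a] [b|b] /= E.
    - by congr inl; apply: val_inj.
    - by case/eqP: (disj _ _ (valP a) (valP b)).
    - by case/eqP: (disj _ _ (valP b) (valP a)).
    - by congr inr; apply: val_inj.
  by rewrite card_sum -!/(gorder _) !gorder_induced TE cardsC.
case=> [a|a] [b|b] //=; apply/negbTE; first exact: nST (valP a) (valP b).
by rewrite edge_sym; apply: nST (valP b) (valP a).
Qed.

(** Every vertex reaches the new vertex, through [x1] or [x2]. *)
Lemma add_vertex_connectedg (G1 G2 : sgraph) (N : {set vert (gunion G1 G2)}) x1 x2 :
  connectedg G1 -> connectedg G2 -> inl x1 \in N -> inr x2 \in N ->
  connectedg (add_vertex N).
Proof.
move=> [_ conn1] [_ conn2] x1N x2N; split.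
  by apply/card_gt0P; exists None.
have to_None (z : vert (add_vertex N)) : connect (@edge (add_vertex N)) z None.
  case: z => [[a|b]|]; last exact: connect0.
    apply: (@connect_trans _ _ (Some (inl x1))); last exact: connect1.
    by apply: (@connect_homo _ _ (@edge G1) _ (Some \o inl)) (conn1 a x1).
  apply: (@connect_trans _ _ (Some (inr x2))); last exact: connect1.
  by apply: (@connect_homo _ _ (@edge G2) _ (Some \o inr)) (conn2 b x2).
by move=> x y; apply: connect_trans (to_None x) _; rewrite connect_edge_sym.
Qed.

(** The one vertex [w] outside [S] and [T] plays the role of [K1], with [N] its neighbourhood; its
    neighbours [s] and [t] provide connectedness. *)
Lemma bullet_induced (G : sgraph) (S T : {set vert G}) w s t :
  [disjoint S & T] -> ~: (S :|: T) = [set w] ->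
  (forall x y, x \in S -> y \in T -> ~~ edge x y) ->
  connectedg (induced S) -> connectedg (induced T) ->
  s \in S -> t \in T -> edge s w -> edge t w ->
  bullet (induced S) (induced T) G.
Proof.
move=> dST wE nST connS connT sS tT sw tw.
pose g (z : vert (gunion (induced S) (induced T))) : vert G :=
  match z with inl a => val a | inr b => val b end.
pose h (z : option (vert (gunion (induced S) (induced T)))) : vert G :=
  if z is Some z' then g z' else w.
pose N := [set z | edge w (g z)].
have disj a b : a \in S -> b \in T -> a != b.
  by move=> aS; apply: contraTneq => <-; rewrite (disjointFr dST aS).
have [wS wT] : w \notin S /\ w \notin T.
  by have := set11 w; rewrite -wE !inE negb_or => /andP.
exists N; split.
  apply: (@add_vertex_connectedg (induced S) (induced T) N
    (exist _ s sS) (exist _ t tT)) => //;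
  by rewrite inE /= edge_sym.
apply: isog_sym; exists h; last first.
  case=> [[a|a]|] [[b|b]|] //=; rewrite ?inE ?edge_irrefl //=.
  - by apply/negbTE; apply: nST (valP a) (valP b).
  - by rewrite edge_sym.
  - by rewrite edge_sym; apply/negbTE; apply: nST (valP b) (valP a).
  - by rewrite edge_sym.
apply: inj_card_bij.
  case=> [[a|a]|] [[b|b]|] //= E.
  - by congr (Some (inl _)); apply: val_inj.
  - by case/eqP: (disj _ _ (valP a) (valP b)).
  - by case/negP: wS; rewrite -E; apply: valP a.
  - by case/eqP: (disj _ _ (valP b) (valP a)).
  - by congr (Some (inr _)); apply: val_inj.
  - by case/negP: wT; rewrite -E; apply: valP a.
  - by case/negP: wS; rewrite E; apply: valP b.
  - by case/negP: wT; rewrite E; apply: valP b.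
rewrite card_option card_sum -!/(gorder _) !gorder_induced.
rewrite /gorder -(cardsC (S :|: T)) wE cards1 cardsU.
by move: dST; rewrite -setI_eq0 => /eqP ->; rewrite cards0 subn0 addn1.
Qed.

Lemma le_rho2_gunion (R : realType) (G G1 G2 : sgraph) (a : R) :
  isog G (gunion G1 G2) -> (0 < gorder G1)%N -> (0 < gorder G2)%N ->
  a <= rho R 1 G1 -> a <= rho R 1 G2 -> a <= rho R 2 G.
Proof.
move=> /isog_sym[f /bij_inj inj_f fE].
apply: (le_rho2_embed (h1 := f \o inl) (h2 := f \o inr)) => [|||||] x y /=.
- by move=> /inj_f[].
- by move=> /inj_f[].
- by rewrite (inj_eq inj_f).
- by rewrite fE.
- by rewrite fE.
- by rewrite fE.
Qed.

Lemma le_rho2_bullet (R : realType) (G G1 G2 : sgraph) (a : R) :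
  bullet G1 G2 G -> (0 < gorder G1)%N -> (0 < gorder G2)%N ->
  a <= rho R 1 G1 -> a <= rho R 1 G2 -> a <= rho R 2 G.
Proof.
move=> [N [_ /isog_sym[f /bij_inj inj_f fE]]].
apply: (le_rho2_embed (h1 := f \o (Some \o inl)) (h2 := f \o (Some \o inr)))
  => [|||||] x y /=.
- by move=> /inj_f[].
- by move=> /inj_f[].
- by rewrite (inj_eq inj_f).
- by rewrite fE.
- by rewrite fE.
- by rewrite fE.
Qed.

Lemma le_rho2_gunion2_K1 (R : realType) (G G1 G2 : sgraph) (a : R) :
  isog G (gunion (gunion G1 G2) K1) -> (0 < gorder G1)%N -> (0 < gorder G2)%N ->
  a <= rho R 1 G1 -> a <= rho R 1 G2 -> a <= rho R 2 G.
Proof.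
move=> /isog_sym[f /bij_inj inj_f fE].
apply: (le_rho2_embed (h1 := f \o (inl \o inl)) (h2 := f \o (inl \o inr)))
  => [|||||] x y /=.
- by move=> /inj_f[].
- by move=> /inj_f[].
- by rewrite (inj_eq inj_f).
- by rewrite fE.
- by rewrite fE.
- by rewrite fE.
Qed.

(* A component carrying a nonzero part of a top eigenfunction has the same
   spectral radius. *)
Lemma rho1_component (R : realType) (H : sgraph) (x y : vert H) :
  ~~ connect (@edge H) x y ->
  exists S : {set vert H},
    [/\ S != set0, (#|S| < gorder H)%N & rho R 1 H <= rho R 1 (induced S)].
Proof.
move=> nxy; have H_gt0 : (0 < gorder H)%N by apply/card_gt0P; exists x.
have [u u_gt0 uE] := rho1_attained R H_gt0.
pose part (A : {set vert H}) z := u z * (z \in A)%:R.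
pose S := [set z | connect (@edge H) x z].
have partN (A : {set vert H}) z : z \notin A -> part A z = 0 by rewrite /part => /negPf ->; rewrite mulr0.
have nS a b : a \in S -> b \notin S -> ~~ edge a b.
  rewrite !inE => xa; apply: contra => ab.
  by apply: connect_trans xa (connect1 ab).
have uS z : u z = 1 * part S z + 1 * part (~: S) z.
  by rewrite /part in_setC; case: (z \in S); rewrite /= ?mulr1 ?mulr0; ring.
have dotS : dotf (part S) (part (~: S)) = 0.
  rewrite /dotf big1 // => z _; rewrite /part in_setC.
  by case: (z \in S); rewrite /= ?mulr0 ?mul0r.
have formS : adjform (part S) (part (~: S)) = 0.
  rewrite /adjform big1 // => a _; have [aS|aS] := boolP (a \in S); last first.
    by rewrite partN // mul0r.
  rewrite big1 ?mulr0 // => b _; have [bS|bS] := boolP (b \in S).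
    by rewrite partN ?mulr0 // in_setC bS.
  by rewrite (negPf (nS _ _ aS bS)) mul0r.
have dotE : dotf u u = dotf (part S) (part S) + dotf (part (~: S)) (part (~: S)).
  transitivity (dotf (fun z => 1 * part S z + 1 * part (~: S) z)
                     (fun z => 1 * part S z + 1 * part (~: S) z)).
    by apply: eq_bigr => z _; rewrite -uS.
  rewrite dotf_linearr ![dotf _ (part _)]dotfC !dotf_linearr.
  rewrite [dotf (part (~: S)) (part S)]dotfC dotS; ring.
have formE : adjform u u =
    adjform (part S) (part S) + adjform (part (~: S)) (part (~: S)).
  rewrite (eq_adjform uS uS).
  rewrite adjform_linearr ![adjform _ (part _)]adjformC !adjform_linearr.
  rewrite [adjform (part (~: S)) (part S)]adjformC formS; ring.
rewrite {}formE {}dotE mulrDr in uE u_gt0.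
(* The two Rayleigh bounds add up to the equality [uE], so both are tight. Whichever part of [u] is
   nonzero then gives the required set. *)
have le1 := adjform_le_rho1 (part S); have le2 := adjform_le_rho1 (part (~: S)).
have xS : x \in S by rewrite inE.
have yS : y \notin S by rewrite inE.
have proper_card (A : {set vert H}) z : z \notin A -> (#|A| < gorder H)%N.
  by move=> zA; rewrite /gorder -cardsT proper_card //; apply/properP; split;
    [exact: subsetT | exists z].
have [S_gt0|S_le0] := ltP 0 (dotf (part S) (part S)).
  exists S; split; [by apply/set0Pn; exists x | exact: proper_card yS |].
  by apply: le_rho1_induced S_gt0 _; [exact: partN | lra].
exists (~: S); split.
- by apply/set0Pn; exists y; rewrite in_setC.
- by apply: (proper_card _ x); rewrite in_setC xS.
- by apply: (le_rho1_induced (f := part (~: S))); [exact: partN | lra | lra].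
Qed.

(** * Extremal graphs of the class and the upper bound *)

Section ExtremalGraphs.
Variables (R : realType) (C : sgraph -> Prop) (alpha : nat -> R).
Hypothesis C_class : graph_class C.
Hypothesis alpha_max : forall s : nat, (0 < s)%N -> is_max_rho1 C s (alpha s).
Hypothesis alpha_incr :
  forall s t : nat, (0 < s)%N -> (s < t)%N -> alpha s < alpha t.

Lemma rho1_induced_le (G : sgraph) (S : {set vert G}) :
  C G -> S != set0 -> rho R 1 (induced S) <= alpha #|S|.
Proof.
case: C_class => _ hered CG S0.
have /alpha_max[_ le] : (0 < #|S|)%N by rewrite card_gt0.
by apply: le; [exact: hered | exact: gorder_induced].
Qed.

Lemma alpha_leE (s t : nat) :
  (0 < s)%N -> (0 < t)%N -> (alpha s <= alpha t) = (s <= t)%N.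
Proof.
move=> s0 t0; apply/idP/idP; last first.
  by rewrite leq_eqVlt => /predU1P[-> //|/(alpha_incr s0)/ltW].
by apply: contraTT; rewrite -ltnNge -ltNge; apply: alpha_incr.
Qed.

(** Otherwise a proper induced subgraph, again in the class, would have spectral radius at least
    [alpha s], against strict monotonicity. *)
Lemma extremal_connectedg (s : nat) (H : sgraph) :
  (0 < s)%N -> extremal C alpha s H -> connectedg H.
Proof.
move=> s0 [CH Hs Hrho].
split=> [|x y]; first by rewrite Hs.
apply/negPn/negP => /(rho1_component R)[S [S0 S_lt le_S]].
have := le_trans le_S (rho1_induced_le CH S0).
by rewrite Hrho alpha_leE ?card_gt0 // -Hs leqNgt S_lt.
Qed.

Lemma rho2_le_alpha (G : sgraph) :
  C G -> (1 < gorder G)%N -> rho R 2 G <= alpha (gorder G)./2.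
Proof.
move=> CG n_gt1.
have [S [T [[S0 T0 dST] leS leT _]]] := second_eigenvalue_sets R n_gt1.
have cardST : (#|S| + #|T| <= gorder G)%N.
  by rewrite -leq_card_setU in dST; rewrite -(eqP dST) max_card.
have small (U : {set vert G}) : U != set0 -> rho R 2 G <= rho R 1 (induced U) ->
    (#|U| <= (gorder G)./2)%N -> rho R 2 G <= alpha (gorder G)./2.
  move=> U0 /le_trans/(_ (rho1_induced_le CG U0)) /le_trans le_U cU.
  by apply: le_U; rewrite alpha_leE ?card_gt0 //; lia.
have [cS|cS] := leqP #|S| (gorder G)./2; first exact: small (leS _ (subxx _)) cS.
by apply: small (leT _ (subxx _)) _ => //; lia.
Qed.

(** Monotonicity of [alpha] gives both sets at least [m] vertices, and [n <= 2m + 1] leaves one of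
    them with exactly [m]; that one is called [S]. It is extremal, so its spectral radius equals
    [rho_2], which excludes edges to [T]. The other set may have [m + 1] vertices, so only a lower
    bound on its size is stated. *)
Lemma rho2_eq_alpha_sets (G : sgraph) (m := (gorder G)./2) :
  C G -> (1 < gorder G)%N -> rho R 2 G = alpha m ->
  exists S T : {set vert G},
  [/\ extremal C alpha m (induced S), [disjoint S & T] /\ (m <= #|T|)%N,
      forall x y, x \in S -> y \in T -> ~~ edge x y,
      forall U : {set vert G}, S \subset U -> alpha m <= rho R 1 (induced U)
    & forall U : {set vert G}, T \subset U -> alpha m <= rho R 1 (induced U)].
Proof.
move=> CG n_gt1 rhoE; have [_ hered] := C_class.
have [S [T [[S0 T0 dST] leS leT nST]]] := second_eigenvalue_sets R n_gt1.
have cardST : (#|S| + #|T| <= gorder G)%N.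
  by move: (dST); rewrite -leq_card_setU => /eqP <-; apply: max_card.
have m0 : (0 < m)%N by rewrite /m; lia.
have large (U : {set vert G}) : U != set0 -> rho R 2 G <= rho R 1 (induced U) ->
    (m <= #|U|)%N.
  move=> U0 /le_trans/(_ (rho1_induced_le CG U0)).
  by rewrite rhoE alpha_leE ?card_gt0.
have small (U : {set vert G}) : U != set0 -> rho R 2 G <= rho R 1 (induced U) ->
    #|U| = m -> extremal C alpha m (induced U).
  move=> U0 le_U cU; split; [exact: hered | by rewrite gorder_induced |].
  by apply/le_anti; rewrite -{1}cU rho1_induced_le //= -rhoE.
have mS := large _ S0 (leS _ (subxx _)); have mT := large _ T0 (leT _ (subxx _)).
have [cS|cS] := eqVneq #|S| m.
  have extS := small _ S0 (leS _ (subxx _)) cS.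
  exists S, T; rewrite -rhoE; split=> //.
  by apply: nST; left; case: extS => _ _ ->; rewrite rhoE.
have cT : #|T| = m by move: cS; rewrite /m in mS mT *; lia.
have extT := small _ T0 (leT _ (subxx _)) cT.
exists T, S; rewrite -rhoE; split=> //; first by rewrite disjoint_sym.
move=> x y xT yS; rewrite edge_sym; move: yS xT; apply: nST.
by right; case: extT => _ _ ->; rewrite rhoE.
Qed.

End ExtremalGraphs.

(** * Structure in the equality case, by parity of the order *)

Section EqualityCases.
Variables (R : realType) (C : sgraph -> Prop) (alpha : nat -> R).
Hypothesis C_class : graph_class C.
Hypothesis alpha_max : forall s : nat, (0 < s)%N -> is_max_rho1 C s (alpha s).
Hypothesis alpha_incr :
  forall s t : nat, (0 < s)%N -> (s < t)%N -> alpha s < alpha t.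
Variable G : sgraph.
Hypothesis CG : C G.
Hypothesis n_gt1 : (1 < gorder G)%N.
Let m := (gorder G)./2.
Hypothesis rhoE : rho R 2 G = alpha m.

Lemma rho2_eq_alpha_even :
  ~~ odd (gorder G) ->
  exists G1 G2 : sgraph,
    [/\ extremal C alpha m G1, extremal C alpha m G2 & isog G (gunion G1 G2)].
Proof.
move=> even_n.
have [S [T [extS [dST mT] nST _ leT]]] :=
  rho2_eq_alpha_sets C_class alpha_max alpha_incr CG n_gt1 rhoE.
have cS : #|S| = m by have [_ + _] := extS; rewrite gorder_induced.
(* Disjoint sets of sizes [m] and at least [m] exhaust the [2m] vertices. *)
have TE : T = ~: S.
  apply/eqP; rewrite eqEcard -disjoints_subset disjoint_sym dST /=.
  by rewrite -(leq_add2l #|S|) cardsC cS -/(gorder G); rewrite /m in mT *; lia.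
exists (induced S), (induced T); split=> //; last exact: isog_gunion_induced.
have cT : #|T| = m by have := cardsC S; rewrite -TE cS -/(gorder G) /m; lia.
have T0 : T != set0 by rewrite -card_gt0 cT /m; lia.
split; [by case: C_class => _; apply | by rewrite gorder_induced |].
apply/le_anti; rewrite leT ?subxx // -cT andbT.
exact: (rho1_induced_le C_class alpha_max).
Qed.

Lemma rho2_eq_alpha_odd :
  odd (gorder G) ->
  (exists G1 G2 : sgraph,
     [/\ extremal C alpha m G1, C G2, gorder G2 = uphalf (gorder G),
         rho R 1 G1 <= rho R 1 G2 & isog G (gunion G1 G2)]) \/
  (exists G1 G2 : sgraph,
     [/\ extremal C alpha m G1, extremal C alpha m G2 & bullet G1 G2 G]).
Proof.
move=> odd_n; have [_ hered] := C_class.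
have [S [T [extS [dST mT] nST leS leT]]] :=
  rho2_eq_alpha_sets C_class alpha_max alpha_incr CG n_gt1 rhoE.
have m0 : (0 < m)%N by rewrite /m; lia.
(* Used with [A] equal to [S] or to [T]. The complement contains the other set, so its spectral
   radius is bounded below by the superset clauses. *)
have union_case (A : {set vert G}) : extremal C alpha m (induced A) ->
    alpha m <= rho R 1 (induced (~: A)) ->
    (forall x y, x \in A -> y \in ~: A -> ~~ edge x y) ->
    exists G1 G2 : sgraph,
     [/\ extremal C alpha m G1, C G2, gorder G2 = uphalf (gorder G),
         rho R 1 G1 <= rho R 1 G2 & isog G (gunion G1 G2)].
  move=> extA le_A nA; have [_ cA rhoA] := extA.
  exists (induced A), (induced (~: A)).
  have cAC : #|~: A| = uphalf (gorder G).
    have := cardsC A; rewrite -/(gorder G) -gorder_induced cA uphalf_half odd_n.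
    by rewrite /m; lia.
  split=> //; [|by rewrite gorder_induced|by rewrite rhoA|exact: isog_gunion_induced].
  by apply: hered => //; rewrite -card_gt0 cAC; lia.
have TsubS : T \subset ~: S by rewrite -disjoints_subset disjoint_sym.
have SsubT : S \subset ~: T by rewrite -disjoints_subset.
have cS : #|S| = m by have [_ + _] := extS; rewrite gorder_induced.
(* If no edge leaves [S], the graph splits into [S] and its complement. Otherwise such an edge ends
   at a vertex [w] outside [T] as well, which forces [T] to have exactly [m] vertices and [w] to be
   the only vertex left over. *)
have [/existsP[s /existsP[w /and3P[sS wS sw]]]|/existsPn nS] :=
    boolP [exists s, exists w, [&& s \in S, w \in ~: S & edge s w]]; last first.
  left; apply: (union_case S) => //; first exact: leT.
  move=> x y xS yS; have /existsPn/(_ y) := nS x; by rewrite xS yS.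
have wT : w \notin T by apply: contraTN sw => /(nST _ _ sS).
have wST : w \in ~: (S :|: T) by rewrite in_setC in_setU negb_or wT andbT -in_setC.
have cU : #|S :|: T| = (#|S| + #|T|)%N.
  by apply/eqP; rewrite (leq_card_setU S T).
have cW : (0 < #|~: (S :|: T)|)%N by apply/card_gt0P; exists w.
have cUC := cardsC (S :|: T); rewrite cU cS -/(gorder G) in cUC.
have cT : #|T| = m by move: cUC cW mT; rewrite /m; lia.
have wE : ~: (S :|: T) = [set w].
  apply/eqP; rewrite eq_sym eqEcard sub1set wST cards1 /=.
  by move: cUC; rewrite cT /m; lia.
have T0 : T != set0 by rewrite -card_gt0 cT.
have extT : extremal C alpha m (induced T).
  split; [exact: hered | by rewrite gorder_induced |].
  apply/le_anti; rewrite leT ?subxx // -cT andbT.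
  exact: (rho1_induced_le C_class alpha_max).
(* If [w] also has a neighbour in [T], the graph is a bullet, connected because both extremal parts
   are. If not, no edge leaves [T], and [T] becomes the starred part of a disjoint union. *)
have [/existsP[t /andP[tT tw]]|/existsPn nT] := boolP [exists t, (t \in T) && edge t w].
  right; exists (induced S), (induced T); split=> //.
  have conn := extremal_connectedg C_class alpha_max alpha_incr m0.
  exact: (bullet_induced dST wE nST (conn _ extS) (conn _ extT) sS tT sw tw).
left; apply: (union_case T) => //; first exact: leS.
move=> x y xT; rewrite in_setC => yT.
have [yS|yS] := boolP (y \in S); first by rewrite edge_sym; apply: nST.
have : y \in ~: (S :|: T) by rewrite in_setC in_setU negb_or yS.
by rewrite wE inE => /eqP ->; have := nT x; rewrite xT.
Qed.

End EqualityCases.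

Theorem theorem1p4 (R : realType) (C : sgraph -> Prop) (alpha : nat -> R)
    (C_class : graph_class C)
    (alpha_max : forall s : nat, (0 < s)%N -> is_max_rho1 C s (alpha s))
    (alpha_incr : forall s t : nat, (0 < s)%N -> (s < t)%N -> alpha s < alpha t)
    (G : sgraph) (CG : C G) (n : nat) (Gn : gorder G = n) (n_ge2 : (2 <= n)%N) :
  [/\ rho R 2 G <= alpha n./2,
      (~~ odd n ->
        (rho R 2 G = alpha n./2 <->
         exists G1 G2 : sgraph,
           [/\ extremal C alpha n./2 G1,
               extremal C alpha n./2 G2
             & isog G (gunion G1 G2)])),
      (odd n ->
        (rho R 2 G = alpha n./2 <->
         (exists G1 G2 : sgraph,
            [/\ extremal C alpha n./2 G1,
                C G2, gorder G2 = uphalf n,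
                rho R 1 G1 <= rho R 1 G2
              & isog G (gunion G1 G2)]) \/
         (exists G1 G2 : sgraph,
            [/\ extremal C alpha n./2 G1,
                extremal C alpha n./2 G2
              & bullet G1 G2 G]))),
      (odd n ->
        (exists2 G1 : sgraph,
           extremal C alpha n./2 G1
         & isog G (gunion (gunion G1 G1) K1)) \/
        (exists G1 G2 : sgraph,
           [/\ extremal C alpha n./2 G1,
               extremal C alpha (uphalf n) G2
             & isog G (gunion G1 G2)]) ->
        rho R 2 G = alpha n./2)
    & (connectedg G ->
        (rho R 2 G = alpha n./2 <->
         odd n /\
         exists G1 G2 H : sgraph,
           [/\ extremal C alpha n./2 G1,
               extremal C alpha n./2 G2,
               bullet G1 G2 H, C H
             & isog G H]))].
Proof.
subst n; set m := (gorder G)./2.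
have m0 : (0 < m)%N by rewrite /m; lia.
have rho_le : rho R 2 G <= alpha m.
  exact: (rho2_le_alpha C_class alpha_max alpha_incr CG n_ge2).
have extremal_gt0 H : extremal C alpha m H -> (0 < gorder H)%N.
  by case=> _ -> _.
have extremal_le H : extremal C alpha m H -> alpha m <= rho R 1 H.
  by case=> _ _ ->.
(* Given the upper bound, each converse needs only [alpha m <= rho_2], supplied by two separated
   subgraphs of spectral radius at least [alpha m]. *)
have bullet_eq G1 G2 : extremal C alpha m G1 -> extremal C alpha m G2 ->
    bullet G1 G2 G -> rho R 2 G = alpha m.
  move=> e1 e2 b; apply/le_anti; rewrite rho_le /=.
  exact: (le_rho2_bullet b (extremal_gt0 _ e1) (extremal_gt0 _ e2)
    (extremal_le _ e1) (extremal_le _ e2)).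
have gunion_eq G1 G2 : extremal C alpha m G1 -> (0 < gorder G2)%N ->
    alpha m <= rho R 1 G2 -> isog G (gunion G1 G2) -> rho R 2 G = alpha m.
  move=> e1 c2 r2 iG; apply/le_anti; rewrite rho_le /=.
  exact: (le_rho2_gunion iG (extremal_gt0 _ e1) c2 (extremal_le _ e1) r2).
have half_lt : odd (gorder G) -> (m < uphalf (gorder G))%N.
  by move=> odd_n; rewrite uphalf_half odd_n.
have odd_eq := rho2_eq_alpha_odd C_class alpha_max alpha_incr CG n_ge2.
split=> //.
- move=> even_n; split=> [rhoE|[G1 [G2 [e1 e2 iG]]]].
    exact: (rho2_eq_alpha_even C_class alpha_max alpha_incr CG n_ge2 rhoE even_n).
  exact: gunion_eq e1 (extremal_gt0 _ e2) (extremal_le _ e2) iG.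
- move=> odd_n; split=> [rhoE|]; first exact: odd_eq.
  case=> [[G1 [G2 [e1 _ c2 r2 iG]]]|[G1 [G2 [e1 e2 b]]]]; last exact: bullet_eq e1 e2 b.
  apply: (gunion_eq G1 G2) => //; first by rewrite c2 (leq_ltn_trans _ (half_lt odd_n)).
  by apply: le_trans r2; apply: extremal_le.
- move=> odd_n [[G1 e1 iG]|[G1 [G2 [e1 [_ c2 r2] iG]]]].
    apply/le_anti; rewrite rho_le /=.
    exact: (le_rho2_gunion2_K1 iG (extremal_gt0 _ e1) (extremal_gt0 _ e1)
      (extremal_le _ e1) (extremal_le _ e1)).
  apply: (gunion_eq G1 G2) => //; first by rewrite c2 (leq_ltn_trans _ (half_lt odd_n)).
  (* The larger starred part has spectral radius [alpha (m + 1)], which exceeds [alpha m]. *)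
  by rewrite r2 ltW // alpha_incr // half_lt.
(* Connectedness rules out every disjoint union, hence the whole even case and the first odd
   alternative. In the remaining one, [H] is [G] itself. *)
- move=> connG; split=> [rhoE|[odd_n [G1 [G2 [H [e1 e2 [N [connN iH]] _ iG]]]]]]; last first.
    by apply: (bullet_eq G1 G2) => //; exists N; split=> //; apply: isog_trans iH.
  have [odd_n|even_n] := boolP (odd (gorder G)).
    split=> //; case: (odd_eq rhoE odd_n) => [[G1 [G2 [e1 _ c2 _ iG]]]|[G1 [G2 [e1 e2 b]]]].
      have c2_gt0 : (0 < gorder G2)%N by rewrite c2 (leq_ltn_trans _ (half_lt odd_n)).
      by case: (gunion_not_connectedg (extremal_gt0 _ e1) c2_gt0 iG).
    by exists G1, G2, G; split=> //; exists id => //; exists id.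
  have [G1 [G2 [e1 e2 iG]]] :=
    rho2_eq_alpha_even C_class alpha_max alpha_incr CG n_ge2 rhoE even_n.
  by case: (gunion_not_connectedg (extremal_gt0 _ e1) (extremal_gt0 _ e2) iG).
Qed.
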